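(* Let $s\geq 4$ be an even integer. For all integers $n,k\geq 1$, \[ D_{s}(n,k)=D_{s}(n-s/2,k-1)+\sum_{\alpha \in \mathbb{A}(s)}D_{s} \Big( n-\frac{s(k-\ell(\alpha))}{2}-| \alpha |,\;k-\ell(\alpha) \Big). \]
   Context: A partition is $s$-duplicate if every part occurring with multiplicity greater than one is divisible by $s/2$. $D_s(n,k)$ is the number of $s$-duplicate partitions of $n$ into exactly $k$ parts. $\mathbb{A}(s)$ is the set consisting of the empty partition together with all partitions into distinct parts each at most $s/2-1$ (so $|\mathbb{A}(s)|=2^{s/2-1}$); for $\alpha\in\mathbb{A}(s)$, $|\alpha|$ is the sum of its parts and $\ell(\alpha)$ its number of parts, with $|\emptyset|=\ell(\emptyset)=0$. Conventions: $D_s(0,0)=1$, $D_s(m,0)=0$ for $m\neq 0$, and $D_s(m,j)=0$ whenever $m<0$ or $j<0$. *)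

(* Defs.v *)
From HB Require Import structures.
From mathcomp Require Import all_boot all_order all_algebra.

Set Implicit Arguments.
Unset Strict Implicit.
Unset Printing Implicit Defensive.

Import GRing.Theory Num.Theory.

Definition is_partition (p : seq nat) : bool := sorted geq p && (0 \notin p).

Definition duplicate (s : nat) (p : seq nat) : bool :=
  all (fun i => (1 < count_mem i p) ==> (s./2 %| i)) p.

(* A part of a partition of [n] is at most [n], so letting the parts range    *)
(* over ['I_n.+1] only serves to make the set finite.                         *)
Definition duplicate_partitions (s n k : nat) : {set k.-tuple 'I_n.+1} :=
  [set t : k.-tuple 'I_n.+1 |
    let p := [seq val i | i <- t] in
    [&& is_partition p, sumn p == n & duplicate s p]].

Definition D (s : nat) (m j : int) : nat :=
  match m, j with
  | Posz n, Posz k => #|duplicate_partitions s n k|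
  | _, _ => 0
  end.

(* Distinct parts in [1, s/2 - 1] number at most s/2 - 1, so the length bound *)
(* of the bounded sequences excludes nothing.                                 *)
Definition A (s : nat) : {set {bseq (s./2).-1 of 'I_s./2}} :=
  [set a : {bseq (s./2).-1 of 'I_s./2} |
    let p := [seq val i | i <- a] in is_partition p && uniq p].

Definition len (s : nat) (a : {bseq (s./2).-1 of 'I_s./2}) : nat := size a.

Definition weight (s : nat) (a : {bseq (s./2).-1 of 'I_s./2}) : nat :=
  sumn [seq val i | i <- a].

Lemma duplicate_partitionsP (s n k : nat) (p : seq nat) :
  reflect
    (exists2 t, t \in duplicate_partitions s n k & p = [seq val i | i <- t])
    [&& is_partition p, size p == k, sumn p == n & duplicate s p].
Proof.
apply: (iffP and4P) => [[pp /eqP <- /eqP sp dp]|[t]]; last first.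
  by rewrite inE => /and3P[pp sp dp] ->; split=> //; rewrite size_map size_tuple.
have vK : map val (map (@inord n) p) = p.
  rewrite -map_comp map_id_in // => i ip /=; rewrite inordK // ltnS -sp.
  by rewrite sumnE (big_rem i) //= leq_addr.
exists (map_tuple (@inord n) (in_tuple p)); last by rewrite /= vK.
by rewrite inE /= vK pp sp dp eqxx.
Qed.

Lemma AP (s : nat) (p : seq nat) : 1 < s ->
  reflect (exists2 a, a \in A s & p = [seq val i | i <- a])
    [&& is_partition p, uniq p & all (fun i => i <= s./2 - 1) p].
Proof.
rewrite /A -half_gt0; case: (s./2) => // h _; rewrite subn1 /=.
apply: (iffP and3P) => [[pp up /allP ap]|[a]]; last first.
  rewrite inE => /andP[pp up] ->; split=> //.
  by apply/allP=> _ /mapP[i _ ->]; rewrite -ltnS.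
have vK : map val (map (@inord h) p) = p.
  by rewrite -map_comp map_id_in // => i ip /=; rewrite inordK // ltnS ap.
have sz : size (map (@inord h) p) <= h.
  rewrite size_map -(size_iota 1 h); apply: uniq_leq_size => // i ip.
  rewrite mem_iota add1n ltnS ap // andbT lt0n.
  by apply: contraTneq ip => ->; case/andP: pp.
exists (Bseq sz); last by rewrite /= vK.
by rewrite inE /= vK pp up.
Qed.

(* Main.v *)
Require Import Defs.
From mathcomp Require Import all_boot all_order all_algebra.
From mathcomp Require Import zify.

(** Put h = s/2 and split the s-duplicate partitions of n into k parts according
    to whether h is a part. Removing one copy of h from those containing it
    leaves an arbitrary s-duplicate partition of n - h into k - 1 parts. In those
    without h, the parts below h are not divisible by h, hence distinct, and form
    some alpha in A(s); the other k - l(alpha) parts exceed h, and subtracting h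
    from each gives an arbitrary s-duplicate partition into k - l(alpha) parts. *)

Local Open Scope ring_scope.

(** The sets counted by [D] live in tuple types that vary with [n] and [k]. As lists over [seq nat]
    they become comparable, and the recurrence becomes an equality of list sizes. *)
Definition dup_seqs (s : nat) (m j : int) : seq (seq nat) :=
  match m, j with
  | Posz n, Posz k =>
      [seq [seq val i | i <- tval t] | t <- enum (duplicate_partitions s n k)]
  | _, _ => [::]
  end.

Lemma size_dup_seqs (s : nat) (m j : int) : size (dup_seqs s m j) = D s m j.
Proof. by case: m j => [n|n] [k|k] //=; rewrite size_map -cardE. Qed.

Lemma dup_seqs_uniq (s : nat) (m j : int) : uniq (dup_seqs s m j).
Proof.
case: m j => [n|n] [k|k] //=; rewrite map_inj_uniq ?enum_uniq // => t u.
by move/(inj_map val_inj)/val_inj.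
Qed.

Lemma mem_dup_seqs (s : nat) (m j : int) (p : seq nat) :
  (p \in dup_seqs s m j) =
  [&& is_partition p, (size p)%:Z == j, (sumn p)%:Z == m & duplicate s p].
Proof.
case: m j => [n|n] [k|k] /=; rewrite ?andbF ?in_nil //.
rewrite !eqz_nat; apply/mapP/idP => [[t]|/duplicate_partitionsP[t tP ->]].
  by rewrite mem_enum => tP ->; apply/duplicate_partitionsP; exists t.
by exists t; rewrite ?mem_enum.
Qed.

Lemma duplicateP s p :
  reflect (forall i, (1 < count_mem i p)%N -> (s./2 %| i)%N) (duplicate s p).
Proof.
apply: (iffP allP) => [dp i ci|dp i _]; last by apply/implyP/dp.
by apply: (implyP (dp i _) ci); rewrite -has_pred1 has_count ltnW.
Qed.

Lemma geq_trans : transitive geq.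
Proof. by move=> y x z /= yx zy; apply: leq_trans yx. Qed.

Lemma geq_anti : antisymmetric geq.
Proof. by move=> x y /= /andP[yx xy]; apply/eqP; rewrite eqn_leq xy yx. Qed.

Lemma geq_total : total geq.
Proof. by move=> x y; apply: leq_total. Qed.

Lemma perm_duplicate s p q : perm_eq p q -> duplicate s p = duplicate s q.
Proof.
by move=> pq; apply/duplicateP/duplicateP => dp i; move/(_ i): dp;
  rewrite (permP pq).
Qed.

(** Only the multiplicity of [s./2] changes, and this part may repeat freely because it divides
    itself. *)
Lemma duplicate_cons_half s q : duplicate s (s./2 :: q) = duplicate s q.
Proof.
apply/duplicateP/duplicateP => dq i /= ci; first by apply: dq => /=; lia.
by have [<-//|ne] := eqVneq s./2 i; apply: dq; move: ci; rewrite (negPf ne).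
Qed.

Definition insert_part (h : nat) (q : seq nat) : seq nat := sort geq (h :: q).

Lemma perm_insert_part h q : perm_eq (insert_part h q) (h :: q).
Proof. by rewrite perm_sort. Qed.

(** A nonincreasing sequence is determined by its multiset of parts, and a common extra part [h]
    cancels in multisets. *)
Lemma insert_part_inj h : {in sorted geq &, injective (insert_part h)}.
Proof.
move=> p q sp sq e; apply: (sorted_eq geq_trans geq_anti sp sq).
rewrite -(perm_cons h) -(permPr (perm_insert_part h q)) -e perm_sym.
exact: perm_insert_part.
Qed.

(** The inverse map is [rem s./2]. Positivity of [s./2] ensures that the inserted part is a legal
    one. *)
Lemma mem_insert_part (s : nat) (m j : int) (p : seq nat) : (0 < s./2)%N ->
  (p \in [seq insert_part s./2 q | q <- dup_seqs s (m - s./2%:Z) (j - 1)]) =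
  (p \in dup_seqs s m j) && (s./2 \in p).
Proof.
move=> h0; apply/mapP/andP => [[q qE ->]|[pE hp]].
  move: qE; rewrite (mem_dup_seqs _ _ _ q).
  case/and4P=> [/andP[sq q0] /eqP zq /eqP wq dq].
  have pq := perm_insert_part s./2 q; split; last first.
    by rewrite (perm_mem pq) mem_head.
  rewrite mem_dup_seqs /is_partition (perm_mem pq) inE negb_or q0.
  rewrite (perm_size pq) (perm_duplicate _ _ _ pq) duplicate_cons_half dq.
  rewrite (perm_sumn pq) /= sort_sorted ?andbT; last exact: geq_total.
  by apply/and3P; split; lia.
move: pE; rewrite mem_dup_seqs => /and4P[/andP[sp p0] /eqP zp /eqP wp dp].
have pq := perm_to_rem hp; exists (rem s./2 p).
  rewrite mem_dup_seqs /is_partition.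
  rewrite (subseq_sorted geq_trans (rem_subseq _ _) sp).
  rewrite (contra (@mem_rem _ _ _ _) p0).
  rewrite -duplicate_cons_half -(perm_duplicate _ _ _ pq) dp.
  move: zp wp; rewrite (perm_size pq) (perm_sumn pq) /= => zp wp.
  by rewrite andbT; apply/andP; split; lia.
apply: (sorted_eq geq_trans geq_anti sp).
  by apply: sort_sorted; apply: geq_total.
by rewrite (permPl pq) perm_sym perm_insert_part.
Qed.

(** The raised parts come first, so that for [a] below [h] the result is nonincreasing without
    sorting. *)
Definition shift_cat (h : nat) (a q : seq nat) : seq nat :=
  [seq (h + i)%N | i <- q] ++ a.

Lemma filter_shift_cat h a q : all (fun i => i < h)%N a ->
  [seq i <- shift_cat h a q | (i < h)%N] = a /\
  [seq i <- shift_cat h a q | ~~ (i < h)%N] = [seq (h + i)%N | i <- q].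
Proof.
move=> /allP ah; rewrite !filter_cat; split.
  rewrite (@eq_in_filter _ _ pred0) ?filter_pred0.
    exact/all_filterP/allP.
  by move=> _ /mapP[i _ ->] /=; lia.
rewrite [X in _ ++ X](@eq_in_filter _ _ pred0) ?filter_pred0 ?cats0.
  by apply/all_filterP/allP => _ /mapP[i _ ->]; lia.
by move=> i /ah /= ->.
Qed.

Lemma sumn_shift h q : sumn [seq (h + i)%N | i <- q] = (h * size q + sumn q)%N.
Proof. by elim: q => [|i q /= ->]; rewrite ?muln0 //= mulnS; lia. Qed.

Lemma sorted_shift h q : sorted geq [seq (h + i)%N | i <- q] = sorted geq q.
Proof. by rewrite sorted_map; apply: eq_sorted => i j /=; rewrite leq_add2l. Qed.

Lemma count_mem_shift h i q :
  count_mem (h + i)%N [seq (h + i)%N | i <- q] = count_mem i q.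
Proof. by rewrite count_map; apply: eq_count => j /=; rewrite eqn_add2l. Qed.

Lemma sorted_geq_cat p q :
  sorted geq (p ++ q) = [&& allrel geq p q, sorted geq p & sorted geq q].
Proof. by rewrite !(sorted_pairwise geq_trans) pairwise_cat. Qed.

Lemma ltn_dvdnF h i : (0 < i)%N -> (i < h)%N -> (h %| i)%N = false.
Proof. by move=> i0 ih; apply/negP => /(dvdn_leq i0); lia. Qed.

(** A positive part below [s./2] is not divisible by it, so it may occur only once. Raising by
    [s./2] preserves both multiplicities and divisibility by [s./2], so the large parts impose on
    [q] its own condition. *)
Lemma duplicate_shift_cat s a q :
  0%N \notin a -> all (fun i => i < s./2)%N a ->
  duplicate s (shift_cat s./2 a q) = uniq a && duplicate s q.
Proof.
set h := s./2 => a0 /allP ah.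
have count_lt i : (i < h)%N -> count_mem i (shift_cat h a q) = count_mem i a.
  move=> ih; rewrite count_cat (_ : count _ (map _ _) = 0%N) //.
  by apply/count_memPn/mapP => -[j _]; lia.
have count_ge i : count_mem (h + i)%N (shift_cat h a q) = count_mem i q.
  rewrite count_cat count_mem_shift (_ : count _ a = 0%N) ?addn0 //.
  by apply/count_memPn/negP => /ah; lia.
apply/duplicateP/andP => [d|[ua /duplicateP d] i].
  split; last first.
    by apply/duplicateP => i ci; rewrite -(dvdn_addr i (dvdnn h)) d ?count_ge.
  apply/count_mem_uniq => i; have [ia|/count_memPn->//] := boolP (i \in a).
  have i0 : (0 < i)%N by rewrite lt0n; apply: contraNneq a0 => <-.
  have := d i; rewrite -/h ltn_dvdnF ?ah // count_lt ?ah //.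
  move: ia; rewrite -has_pred1 has_count.
  (* Multiplicity 0 contradicts [i \in a], and multiplicity at least 2 would make [s./2] divide
     [i]. *)
  by case: (count_mem i a) => [|[|c]] // _ /(_ isT).
have [ih|hi] := ltnP i h.
  by rewrite count_lt // count_uniq_mem //; case: (i \in a).
by rewrite -(subnKC hi) count_ge dvdn_addr // => /d.
Qed.

(** Sizes add up, and the sum grows by [s./2] for each part of [q] and by the sum of [a]; solving
    for [q] gives the shifted arguments. The value [s./2] can only arise as [s./2 + 0], so its
    absence amounts to [q] having no zero part. *)
Lemma mem_shift_cat (s : nat) (m j : int) (a q : seq nat) :
  is_partition a -> uniq a -> all (fun i => i < s./2)%N a ->
  (shift_cat s./2 a q \in dup_seqs s m j) && (s./2 \notin shift_cat s./2 a q) =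
  (q \in dup_seqs s (m - s./2%:Z * (j - (size a)%:Z) - (sumn a)%:Z)
                    (j - (size a)%:Z)).
Proof.
set h := s./2 => /andP[sa a0] ua ah.
rewrite !mem_dup_seqs duplicate_shift_cat // ua /= -/h.
rewrite /is_partition sorted_geq_cat sorted_shift sa andbT.
have -> : allrel geq [seq (h + i)%N | i <- q] a.
  apply/allrelP => _ x /mapP[i _ ->] /(allP ah) /=; lia.
have -> : (h \notin shift_cat h a q) = (0%N \notin q).
  rewrite mem_cat negb_or -[X in X \notin map _ _](addn0 h).
  rewrite mem_map; last exact: addnI.
  rewrite [h \in a]negbTE ?andbT //; apply/negP => /(allP ah).
  by rewrite ltnn.
have h0q : 0%N \notin q -> 0%N \notin shift_cat h a q.
  by move=> q0; rewrite mem_cat negb_or a0 andbT; apply/mapP => -[i iq];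
    case: i iq => [|i iq]; [rewrite (negPf q0)|lia].
rewrite size_cat size_map sumn_cat sumn_shift /=.
case: (boolP (0%N \in q)) h0q => [_ _|_ /(_ isT)->]; rewrite ?andbF //= !andbT.
case: (sorted geq q) => //=; case: (duplicate s q); rewrite ?andbF ?andbT //.
rewrite PoszD.
have -> : ((size q)%:Z + (size a)%:Z == j) = ((size q)%:Z == j - (size a)%:Z).
  by apply/eqP/eqP; lia.
(* Replacing [j - size a] by [size q] turns both products into the same term, so the rest is
   linear. *)
by case: eqP => //= <-; apply/eqP/eqP; rewrite !PoszD PoszM; lia.
Qed.

(** Cut [p] at [s./2] and lower the large parts by [s./2] to get [q]. That [q] is itself a duplicate
    partition is left to the equivalence [mem_shift_cat]. *)
Lemma shift_cat_split (s : nat) (m j : int) (p : seq nat) :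
  p \in dup_seqs s m j -> s./2 \notin p ->
  exists a q, [/\ is_partition a, uniq a, all (fun i => i < s./2)%N a
    & p = shift_cat s./2 a q].
Proof.
set h := s./2; rewrite mem_dup_seqs => /and4P[/andP[sp p0] _ _ dp] hp.
pose a := [seq i <- p | (i < h)%N].
pose q := [seq (i - h)%N | i <- p & ~~ (i < h)%N].
have qE : [seq (h + i)%N | i <- q] = [seq i <- p | ~~ (i < h)%N].
  rewrite -map_comp map_id_in // => i; rewrite mem_filter /= => /andP[hi _].
  lia.
have sa : sorted geq a by apply: (sorted_filter geq_trans).
have a0 : 0%N \notin a by rewrite mem_filter (negPf p0) andbF.
have ah : all (fun i => i < h)%N a by apply: filter_all.
have pE : p = shift_cat h a q.
  apply: (sorted_eq geq_trans geq_anti sp).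
    rewrite sorted_geq_cat qE sa (sorted_filter geq_trans) // !andbT.
    by apply/allrelP => x y; rewrite !mem_filter /=; lia.
  by rewrite /shift_cat qE perm_sym perm_catC perm_filterC.
exists a, q; split=> //; first by rewrite /is_partition sa.
by move: dp; rewrite pE duplicate_shift_cat // => /andP[].
Qed.

Theorem theorem8 (s : nat) (n k : int) (hs : (4 <= s)%N) (hs2 : ~~ odd s)
    (hn : 1 <= n) (hk : 1 <= k) :
  D s n k =
  (D s (n - s./2%:Z) (k - 1) +
   \sum_(a in A s)
     D s (n - s./2%:Z * (k - (len a)%:Z) - (weight a)%:Z) (k - (len a)%:Z))%N.
Proof.
have h0 : (0 < s./2)%N by lia.
have s1 : (1 < s)%N by lia.
pose parts (a : {bseq (s./2).-1 of 'I_s./2}) := [seq val i | i <- a].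
pose E (a : {bseq (s./2).-1 of 'I_s./2}) :=
  dup_seqs s (n - s./2%:Z * (k - (len a)%:Z) - (weight a)%:Z)
           (k - (len a)%:Z).
have AE a : a \in A s ->
    [/\ is_partition (parts a), uniq (parts a)
      & all (fun i => i < s./2)%N (parts a)].
  rewrite inE => /andP[pa ua]; split=> //.
  by apply/allP => _ /mapP[i _ ->]; apply: ltn_ord.
have memE a q : a \in A s ->
    (q \in E a) = (shift_cat s./2 (parts a) q \in dup_seqs s n k) &&
                  (s./2 \notin shift_cat s./2 (parts a) q).
  by case/AE => pa ua ha; rewrite mem_shift_cat // size_map.
(* The two lists of images: [L1] for the partitions with part [s./2], [L2] for those without it. *)
pose L1 := [seq insert_part s./2 q | q <- dup_seqs s (n - s./2%:Z) (k - 1)].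
pose L2 := [seq shift_cat s./2 (parts a) q | a <- enum (A s), q <- E a].
have memL2 p : (p \in L2) = (p \in dup_seqs s n k) && (s./2 \notin p).
  apply/allpairsPdep/andP => [[a [q [aA qE ->]]]|[pn hp]].
    by apply/andP; rewrite -memE // -mem_enum.
  have [a [q [pa ua ha pE]]] := shift_cat_split _ _ _ _ pn hp.
  have /(AP _ s1)[b bA bE] : [&& is_partition a, uniq a
      & all (fun i => i <= s./2 - 1)%N a].
    by rewrite pa ua; apply: sub_all ha => i; lia.
  exists b, q; split; rewrite ?mem_enum //; last by rewrite pE bE.
  by rewrite memE // /parts -bE -pE pn.
have uL1 : uniq L1.
  rewrite map_inj_in_uniq ?dup_seqs_uniq // => p q.
  rewrite !mem_dup_seqs => /and4P[/andP[sp _] _ _ _] /and4P[/andP[sq _] _ _ _].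
  exact: insert_part_inj.
have uL2 : uniq L2.
  apply: allpairs_uniq_dep => [|a _|]; rewrite ?enum_uniq ?dup_seqs_uniq //.
  move=> _ _ /allpairsPdep[a [q [aA _ ->]]] /allpairsPdep[b [r [bA _ ->]]] /= e.
  rewrite !mem_enum in aA bA; have [[_ _ ha] [_ _ hb]] := (AE a aA, AE b bA).
  (* The parts below [s./2] recover the element of [A s], the others recover [q]. *)
  have [ea eq] := filter_shift_cat _ _ q ha.
  have [eb er] := filter_shift_cat _ _ r hb.
  have -> : a = b.
    by apply/val_inj/(inj_map val_inj); rewrite -/(parts a) -ea e eb.
  by have -> : q = r by apply: (inj_map (@addnI s./2)); rewrite -eq e er.
have sL2 : size L2 = (\sum_(a in A s) size (E a))%N.
  by rewrite size_allpairs_dep sumnE big_map big_enum.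
rewrite -!size_dup_seqs.
rewrite -[X in (X + _)%N](size_map (insert_part s./2)) -/L1.
under eq_bigr do rewrite -size_dup_seqs.
(* Both sides are now sizes of duplicate-free lists, so it suffices that they have the same
   members. *)
rewrite -sL2 -size_cat; apply/perm_size/uniq_perm => [||p].
- exact: dup_seqs_uniq.
- rewrite cat_uniq uL1 uL2 andbT; apply/hasPn => p.
  by rewrite memL2 mem_insert_part // => /andP[_ /negPf ->]; rewrite andbF.
- by rewrite mem_cat memL2 mem_insert_part // -andb_orr orbN andbT.
Qed.
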